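(* Let $\alpha,\beta\in\mathbb{C}$ with $\mathrm{Re}(\beta)>-1$, and let $n\ge 3$ be an integer such that none of the numbers $\alpha k+\beta+1$ ($0\le k\le n$) is a non-positive integer (this is automatic if $\alpha$ is a positive integer). Then for all $z\in\mathbb{C}$, $$ L_n^{(\alpha,\beta)}(z)=-\frac{z}{n}L_{n-1}^{(\alpha,\beta)}(z)+\sum_{m=1}^n(-1)^{m-1}\bigl(\alpha(n-1)+\beta\bigr)_{(m-1)\alpha}\,C_{n,m}\,L_{n-m}^{(\alpha,\beta)}(z), $$ where $$ C_{n,m}=C_{n,m}(\alpha,\beta):=\frac{1}{m!\,n}\sum_{j=0}^m(-1)^j\binom{m}{j}(n-j)\bigl(\alpha(n-j)+\beta\bigr)_{\alpha}. $$
   Context: For an integer $n\ge 0$, the polynomial $L_n^{(\alpha,\beta)}(z)$ (the case $q=1$ of the generalized Laguerre polynomials $L_{\lfloor n/q\rfloor}^{(\alpha,\beta)}(z)$) is $$ L_n^{(\alpha,\beta)}(z)=\frac{\Gamma(\alpha n+\beta+1)}{\Gamma(n+1)}\sum_{k=0}^{n}\frac{(-n)^{(k)}}{\Gamma(\alpha k+\beta+1)}\frac{z^k}{k!}, $$ where $(\gamma)^{(k)}=\gamma(\gamma+1)\cdots(\gamma+k-1)$ is the rising factorial (with $(\gamma)^{(0)}=1$). In particular $L_0^{(\alpha,\beta)}(z)=1$. The falling factorial is $(\gamma)_s:=\Gamma(\gamma+1)/\Gamma(\gamma-s+1)$, used here also for the indices $s=\alpha$ and $s=(m-1)\alpha$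 by this Gamma-function formula, with the convention that $1/\Gamma$ takes the value $0$ at the poles of $\Gamma$. *)

(* Defs.v *)
From HB Require Import structures.
From mathcomp Require Import all_boot all_order all_algebra.
From mathcomp Require Import complex.
From mathcomp Require Import all_classical all_reals all_analysis.
Set Implicit Arguments.
Unset Strict Implicit.
Unset Printing Implicit Defensive.
Import Order.TTheory GRing.Theory Num.Theory.
Import numFieldNormedType.Exports.
Local Open Scope classical_set_scope.
Local Open Scope ring_scope.
Local Open Scope complex_scope.

(* [natpowC p z] is p ^ z = exp (z ln p) for a natural number p > 0. *)
Definition natpowC (R : realType) (p : nat) (z : R[i]) : R[i] :=
  let t := ln (p%:R : R) in
  (expR (complex.Re z * t))%:C *
  (cos (complex.Im z * t) +i* sin (complex.Im z * t)).

Definition risingC (R : realType) (z : R[i]) (k : nat) : R[i] :=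
  \prod_(i < k) (z + i%:R).

Definition gauss_seq (R : realType) (z : R[i]) (p : nat) : R[i] :=
  (p`!)%:R * natpowC p z / risingC z p.+1.

(* Gauss's formula: Gamma z = lim_p p! p^z / (z (z + 1) ... (z + p)) for z not
   a non-positive integer; [R[i]^o] carries the topology of the modulus.
   At a pole the terms are eventually x / 0 = 0, so there Gamma z = 0 and
   (Gamma z)^-1 = 0: a quotient by Gamma z is then 0, which is the convention
   1 / Gamma = 0 at the poles (see [Gamma_pole]). *)
Definition Gamma (R : realType) (z : R[i]) : R[i] :=
  lim ((gauss_seq z : nat -> R[i]^o) @ \oo).

Definition is_nonpos_int (R : realType) (z : R[i]) : Prop :=
  exists p : nat, z = - p%:R.

Lemma Gamma_pole (R : realType) (z : R[i]) : is_nonpos_int z -> Gamma z = 0.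
Proof.
move=> [p ->]; apply: (@cvg_lim R[i]^o); first exact: norm_hausdorff.
apply: cvg_near_cst; near=> q.
rewrite /gauss_seq /risingC.
have pq : (p < q.+1)%N by rewrite ltnS; near: q; exact: nbhs_infty_ge.
by rewrite (bigD1 (Ordinal pq)) //= addNr mul0r invr0 mulr0.
Unshelve. all: by end_near. Qed.

(* The falling factorial (z)_s for an arbitrary complex index s. *)
Definition fallingC (R : realType) (z s : R[i]) : R[i] :=
  Gamma (z + 1) / Gamma (z - s + 1).

Definition Laguerre (R : realType) (alpha beta : R[i]) (n : nat) (z : R[i])
    : R[i] :=
  Gamma (alpha * n%:R + beta + 1) / Gamma (n%:R + 1) *
  \sum_(0 <= k < n.+1)
    risingC (- n%:R) k / Gamma (alpha * k%:R + beta + 1) *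
    (z ^+ k / (k`!)%:R).

Definition Lcoef (R : realType) (alpha beta : R[i]) (n m : nat) : R[i] :=
  ((m`!)%:R * n%:R)^-1 *
  \sum_(0 <= j < m.+1)
    (-1) ^+ j * 'C(m, j)%:R * (n%:R - j%:R) *
    fallingC (alpha * (n%:R - j%:R) + beta) alpha.

(* Main.v *)
Require Import Defs.
From HB Require Import structures.
From mathcomp Require Import all_boot all_order all_algebra.
From mathcomp Require Import complex.
From mathcomp Require Import all_classical all_reals all_analysis.
From mathcomp Require Import zify ring lra.
Set Implicit Arguments.
Unset Strict Implicit.
Unset Printing Implicit Defensive.
Import Order.TTheory GRing.Theory Num.Theory.
Import numFieldNormedType.Exports.
Local Open Scope classical_set_scope.
Local Open Scope ring_scope.
Local Open Scope complex_scope.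

(** Write G k for Gamma (alpha k + beta + 1). Since (-n)^(k) / k! is
    (-1)^k 'C(n, k) and Gamma (n + 1) = n!, the Laguerre polynomial is
    G n / n! times p n := \sum_k 'C(n, k) (-z)^k / G k
    ([Laguerre_binom_poly]). The falling factorials of the recurrence are the
    quotients G (n - j) / G (n - j - 1) and G (n - 1) / G (n - m), so the
    coefficient C_(n, m) is, up to the factor m! n, the alternating binomial
    transform at m of j |-> b (n - j), where b k = k G k / G (k - 1).

    Let D be the transform of j |-> b (n - j). Because D 0 = n G n / G (n - 1),
    the recurrence is a rearrangement of
      \sum_(m <= n) (-1)^m 'C(n, m) D m p (n - m) = - z n p (n - 1)
    ([binom_poly_convolution]), proved coefficient by coefficient: as 'C(n, m) 'C(n - m, k) = 'C(n, k) 'C(n - k, m), the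
    coefficient of (-z)^k / G k on the left is 'C(n, k) times the transform
    of D at n - k. That transform is an involution
    ([binom_transfK]), so this is 'C(n, k) b k, and
    k 'C(n, k) = n 'C(n - 1, k - 1) gives the right-hand side.

    All of this divides by the numbers G k, and so requires that Gamma does not
    vanish outside its poles ([Gamma_neq0]). With Gamma given by Gauss's limit,
    this is a statement about an infinite product: consecutive terms of Gauss's
    sequence have ratio
      (1 + 1/p)^z / (1 + z/(p + 1)) = 1 + e_p,  |e_p| <= K (1/p - 1/(p + 1))
    ([gauss_ratio_le]), and a product of factors 1 + e_p with such a
    telescoping bound converges to a nonzero limit ([product_cvg_neq0]). The
    convergence also yields Gamma (z + 1) = z Gamma z and hence
    Gamma (n + 1) = n!. *)

(** * Binomial inversion and the recurrence over a field *)

Section Algebra.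

Definition binom_transf (V : pzRingType) (a : nat -> V) (m : nat) : V :=
  \sum_(j < m.+1) (-1) ^+ j * 'C(m, j)%:R * a j.

Lemma binom_transf_widen (V : pzRingType) (a : nat -> V) (m N : nat) :
  (m <= N)%N ->
  binom_transf a m = \sum_(j < N.+1) (-1) ^+ j * 'C(m, j)%:R * a j.
Proof.
move=> mN; rewrite /binom_transf.
rewrite (big_ord_widen N.+1 (fun j => (-1) ^+ j * 'C(m, j)%:R * a j))//.
rewrite big_mkcond /=.
apply: eq_bigr => j _; case: ltnP => // mj.
by rewrite bin_small// mulr0 mul0r.
Qed.

(** Pascal's rule: the transform at m is, up to sign, an m-th finite difference. *)
Lemma binom_transfS (V : pzRingType) (a : nat -> V) (m : nat) :
  binom_transf a m.+1 = binom_transf a m - binom_transf (a \o S) m.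
Proof.
rewrite (@binom_transf_widen _ a m m.+1)// /binom_transf ![\sum_(j < m.+2) _]big_ord_recl.
rewrite !bin0 -addrA; congr (_ + _).
rewrite -sumrB; apply: eq_bigr => j _ /=.
rewrite /bump /= add1n binS natrD mulrDr mulrDl; congr (_ + _).
by rewrite exprS !mulN1r !mulNr.
Qed.

(** By induction on m for all sequences at once: applying [binom_transfS] to
    the outer transform, and again to the shifted inner one, leaves the double
    transform of the shifted sequence at m. *)
Lemma binom_transfK (V : pzRingType) (a : nat -> V) (m : nat) :
  binom_transf (binom_transf a) m = a m.
Proof.
elim: m a => [|m IH] a.
  by rewrite /binom_transf !big_ord1 !bin0 !mul1r.
rewrite binom_transfS -[RHS](IH (a \o S)).
rewrite -[RHS](subKr (binom_transf (binom_transf a) m)); congr (_ - _).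
rewrite /binom_transf -sumrB; apply: eq_bigr => j _.
by rewrite -mulrBr -binom_transfS.
Qed.

(** Both sides count the pairs of disjoint subsets of sizes m and k. *)
Lemma bin_mul_bin_sub (n m k : nat) :
  ('C(n, m) * 'C(n - m, k) = 'C(n, k) * 'C(n - k, m))%N.
Proof.
have [mk|nmk] := leqP (m + k) n.
  have mn : (m <= n)%N := leq_trans (leq_addr k m) mk.
  have kn : (k <= n)%N := leq_trans (leq_addl m k) mk.
  have kn' : (k <= n - m)%N by rewrite leq_subRL.
  have mn' : (m <= n - k)%N by rewrite leq_subRL// addnC.
  apply/eqP; rewrite -(@eqn_pmul2r (m`! * k`! * (n - m - k)`!)) ?muln_gt0 ?fact_gt0//.
  apply/eqP; transitivity (n`!).
    by rewrite -(bin_fact mn) -[in X in _ = _ * (_ * X)%N](bin_fact kn'); ring.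
  by rewrite -(bin_fact kn) -(bin_fact mn') -!subnDA [(k + m)%N]addnC; ring.
have z m' k' : (n < m' + k')%N -> ('C(n, m') * 'C(n - m', k') = 0)%N.
  move=> h; have [mn|nm] := leqP m' n; last by rewrite bin_small.
  by rewrite ['C(n - m', k')]bin_small ?muln0// ltn_subLR.
by rewrite !z// addnC.
Qed.

Variables (F : numFieldType) (G : nat -> F) (z : F).

(** With G k = Gamma (alpha k + beta + 1) this is n! / G n times the Laguerre
    polynomial. *)
Definition binom_poly (n : nat) : F :=
  \sum_(k < n.+1) 'C(n, k)%:R * ((- z) ^+ k / G k).

Definition scaled_ratio (k : nat) : F := k%:R * (G k / G k.-1).

Lemma binom_poly_widen (m N : nat) : (m <= N)%N ->
  binom_poly m = \sum_(k < N.+1) 'C(m, k)%:R * ((- z) ^+ k / G k).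
Proof.
move=> mN; rewrite /binom_poly.
rewrite (big_ord_widen N.+1 (fun k => 'C(m, k)%:R * ((- z) ^+ k / G k)))//.
rewrite big_mkcond /=.
apply: eq_bigr => j _; case: ltnP => // mj.
by rewrite bin_small// mul0r.
Qed.

(** The coefficient of (-z)^k / G k on the left is a double binomial transform,
    which [binom_transfK] evaluates. *)
Lemma binom_poly_convolution (n : nat) :
    (forall k, (k <= n.+1)%N -> G k != 0) ->
  \sum_(m < n.+2) (-1) ^+ m * 'C(n.+1, m)%:R *
     binom_transf (fun j => scaled_ratio (n.+1 - j)) m * binom_poly (n.+1 - m) =
  - z * n.+1%:R * binom_poly n.
Proof.
move=> G0; set D := binom_transf _.
pose g k := (- z) ^+ k / G k.
transitivity (\sum_(m < n.+2) \sum_(k < n.+2)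
    'C(n.+1, k)%:R * g k * ((-1) ^+ m * 'C(n.+1 - k, m)%:R * D m)).
  apply: eq_bigr => m _; rewrite (@binom_poly_widen _ n.+1) ?leq_subr//.
  rewrite mulr_sumr; apply: eq_bigr => k _; rewrite -/(g k).
  have E : 'C(n.+1, m)%:R * 'C(n.+1 - m, k)%:R =
           'C(n.+1, k)%:R * 'C(n.+1 - k, m)%:R :> F.
    by rewrite -!natrM bin_mul_bin_sub.
  transitivity ('C(n.+1, m)%:R * 'C(n.+1 - m, k)%:R * g k * ((-1) ^+ m * D m)).
    by ring.
  by rewrite E; ring.
rewrite exchange_big /=.
transitivity (\sum_(k < n.+2) 'C(n.+1, k)%:R * g k * scaled_ratio k).
  apply: eq_bigr => k _; rewrite -mulr_sumr; congr (_ * _).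
  have kn : (k <= n.+1)%N by rewrite -ltnS.
  by rewrite -(@binom_transf_widen _ D) ?leq_subr// binom_transfK subKn.
rewrite big_ord_recl /scaled_ratio mul0r mulr0 add0r mulr_sumr.
apply: eq_bigr => k _; rewrite !lift0 /=.
have E : k.+1%:R * 'C(n.+1, k.+1)%:R = n.+1%:R * 'C(n, k)%:R :> F.
  by rewrite -!natrM mul_bin_diag.
have Gk : G k != 0 by apply: G0; exact: ltnW (ltn_ord k).
have Gk1 : G k.+1 != 0 by apply: G0; exact: ltn_ord k.
transitivity (k.+1%:R * 'C(n.+1, k.+1)%:R * (- z) ^+ k.+1 / G k).
  by rewrite /g; field; rewrite Gk.
by rewrite E exprS; field.
Qed.

(** [binom_poly_convolution] solved for its term m = 0, after multiplication by
    G n / ((n + 1)! (n + 1)). *)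
Lemma binom_poly_recurrence (n : nat) :
    (forall k, (k <= n.+1)%N -> G k != 0) ->
  G n.+1 / (n.+1)`!%:R * binom_poly n.+1 =
  - (z / n.+1%:R) * (G n / n`!%:R * binom_poly n) +
  \sum_(1 <= m < n.+2)
    (-1) ^+ (m - 1) * (G n / G (n.+1 - m)) *
    ((m`!%:R * n.+1%:R)^-1 *
      binom_transf (fun j => scaled_ratio (n.+1 - j)) m) *
    (G (n.+1 - m) / (n.+1 - m)`!%:R * binom_poly (n.+1 - m)).
Proof.
move=> G0; have := @binom_poly_convolution n G0.
set D := binom_transf _; set c := (n.+1`!%:R * n.+1%:R)^-1 * G n.
have f0 k : k`!%:R != 0 :> F by rewrite pnatr_eq0 -lt0n fact_gt0.
have n0 : n.+1%:R != 0 :> F by rewrite pnatr_eq0.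
have Gn : G n != 0 by apply: G0.
rewrite -(big_mkord xpredT (fun m => (-1) ^+ m * 'C(n.+1, m)%:R * D m *
  binom_poly (n.+1 - m))) big_ltn// subn0 bin0 expr0 !mul1r.
have -> : D 0 = n.+1%:R * (G n.+1 / G n).
  by rewrite /D /binom_transf big_ord1 bin0 expr0 !mul1r subn0.
set S := \sum_(1 <= m < n.+2) _ => conv.
transitivity (- c * S + c * (n.+1%:R * (G n.+1 / G n) * binom_poly n.+1 + S)).
  by rewrite /c; field; rewrite nat1r Gn f0 n0.
rewrite conv addrC; congr (_ + _).
  by rewrite /c factS natrM; field; rewrite nat1r !f0 n0.
rewrite mulr_sumr; apply: eq_big_nat => m /andP[m1 mn].
have Gm : G (n.+1 - m) != 0 by apply: G0; rewrite leq_subr.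
have E : 'C(n.+1, m)%:R = n.+1`!%:R / (m`!%:R * (n.+1 - m)`!%:R) :> F.
  by rewrite -(bin_fact (mn : (m <= n.+1)%N)) natrM natrM mulfK// mulf_neq0.
have -> : (-1) ^+ m = - (-1) ^+ (m - 1) :> F.
  by case: m m1 {mn Gm E} => // m _; rewrite subn1 exprS mulN1r.
by rewrite E /c; field; rewrite nat1r Gm !f0 n0.
Qed.

End Algebra.

(** * Second-order bounds for real elementary functions *)

Lemma mulr_norm_sq_le (R : realDomainType) (x y : R) :
  2 * (`|x| * `|y|) <= x ^+ 2 + y ^+ 2.
Proof.
rewrite -[x ^+ 2]real_normK ?num_real// -[y ^+ 2]real_normK ?num_real//.
by have := sqr_ge0 (`|x| - `|y|); nra.
Qed.

Section RealEstimates.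
Variable R : realType.
Implicit Types x y : R.

Lemma norm_sin_le y : `|sin y| <= `|y|.
Proof.
wlog y0 : y / 0 <= y.
  by move=> H; have [/H//|/ltW y0] := leP 0 y;
    rewrite -normrN -sinN -(normrN y) H// oppr_ge0.
have [|c _] := @MVT_segment R sin cos 0 y y0.
  exact/continuous_subspaceT/continuous_sin.
rewrite sin0 !subr0 => ->.
by rewrite normrM ler_piMl// cos_max.
Qed.

Lemma norm_cosB1_le y : `|cos y - 1| <= y ^+ 2 / 2.
Proof.
have -> : cos y - 1 = - (sin (y / 2) ^+ 2 *+ 2).
  have {1}-> : y = (y / 2) *+ 2 by rewrite mulr2n -splitr.
  by rewrite cos_mulr2n cos2sin2 !mulr2n; ring.
rewrite normrN ger0_norm ?mulrn_wge0 ?sqr_ge0//.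
have : sin (y / 2) ^+ 2 <= (y / 2) ^+ 2.
  rewrite -[leLHS]real_normK ?num_real// -[leRHS]real_normK ?num_real//.
  by rewrite ler_sqr ?nnegrE// norm_sin_le.
lra.
Qed.

Lemma norm_sinBid_le y : `|y| <= 1 -> `|sin y - y| <= y ^+ 2.
Proof.
move=> y1; wlog y0 : y y1 / 0 <= y.
  move=> H; have [|/ltW y0] := leP 0 y; first exact: H.
  rewrite -normrN (_ : - (sin y - y) = sin (- y) - - y); last by rewrite sinN; ring.
  by rewrite -(sqrrN y) H ?normrN ?oppr_ge0.
have [|c] := @MVT_segment R sin cos 0 y y0.
  exact/continuous_subspaceT/continuous_sin.
rewrite sin0 !subr0 in_itv/= => /andP[c0 cy] ->.
rewrite (_ : _ - y = (cos c - 1) * y); last ring.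
rewrite normrM (ger0_norm y0) expr2 ler_wpM2r//.
apply: (le_trans (norm_cosB1_le c)).
rewrite ger0_norm// in y1; nra.
Qed.

Lemma norm_expRB1Bid_le x : `|x| <= 1 / 2 -> `|expR x - 1 - x| <= 2 * x ^+ 2.
Proof.
rewrite ler_norml => /andP[x1 x2].
have e1 := expR_ge1Dx x; have e0 := expR_gt0 x.
have /ler_wpM2l : 1 + - x <= (expR x)^-1 by rewrite -expRN expR_ge1Dx.
move=> /(_ _ (ltW e0)); rewrite mulfV ?gt_eqF// => e2.
rewrite ger0_norm; last lra.
nra.
Qed.

(** Both bounds are ln (1 + x) <= x, at x = - 1 / (p + 1) and at x = 1 / p. *)
Lemma ln_succB_bounds (p : nat) : (0 < p)%N ->
  (p.+1)%:R^-1 <= ln (p.+1%:R : R) - ln p%:R <= p%:R^-1.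
Proof.
move=> p0; have P0 : 0 < p%:R :> R by rewrite ltr0n.
have P1 : 0 < p.+1%:R :> R by rewrite ltr0n.
have Ps : p.+1%:R = p%:R + 1 :> R by rewrite -natr1.
apply/andP; split.
  rewrite -lerN2 opprB -ln_div ?posrE//.
  rewrite (_ : _ / _ = 1 + - p.+1%:R^-1); last by rewrite Ps; field; lra.
  by apply: le_ln1Dx; rewrite ltrN2 invf_lt1// Ps; lra.
rewrite -ln_div ?posrE//.
rewrite (_ : _ / _ = 1 + p%:R^-1); last by rewrite Ps; field; lra.
by apply: le_ln1Dx; apply: lt_trans (_ : 0 < _); rewrite ?invr_gt0//; lra.
Qed.

End RealEstimates.

(** * Convergence of complex sequences *)

Section ComplexSequences.
Variable R : realType.
Local Notation normc := (@Normc.normc R).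

Lemma normc_add (x y : R[i]) : normc (x + y) <= normc x + normc y.
Proof. exact: le_normcD. Qed.

Lemma normc_opp (x : R[i]) : normc (- x) = normc x.
Proof. exact: normcN. Qed.

Lemma normc_ge0 (x : R[i]) : 0 <= normc x.
Proof. by case: x => a b; exact: sqrtr_ge0. Qed.

Lemma normc_le_ReIm (x : R[i]) :
  normc x <= `|complex.Re x| + `|complex.Im x|.
Proof.
case: x => a b /=; rewrite -[leRHS]ger0_norm ?addr_ge0// -sqrtr_sqr.
rewrite ler_wsqrtr// sqrrD !real_normK ?num_real//.
by rewrite -addrA lerD2l addrC lerDl mulrn_wge0 ?mulr_ge0.
Qed.

Lemma Re_le_normc (x : R[i]) : `|complex.Re x| <= normc x.
Proof.
by case: x => a b /=; rewrite -sqrtr_sqr ler_wsqrtr// lerDl sqr_ge0.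
Qed.

Lemma Im_le_normc (x : R[i]) : `|complex.Im x| <= normc x.
Proof.
by case: x => a b /=; rewrite -sqrtr_sqr ler_wsqrtr// lerDr sqr_ge0.
Qed.

(** The sequence x + c is nonincreasing, and bounded below since x - c is
    nondecreasing; c itself converges. *)
Lemma real_telescoping_cvg (x c : nat -> R) :
    (forall p, 0 <= c p) -> (forall p, `|x p.+1 - x p| <= c p - c p.+1) ->
  cvg (x @ \oo).
Proof.
move=> c0 xc.
have ccv : cvg (c @ \oo).
  apply: nonincreasing_is_cvgn.
    by apply/nonincreasing_seqP => p; rewrite -subr_ge0; exact: le_trans (xc p).
  by exists 0 => _ [p _ <-].
have xD : cvg ((x + c) @ \oo).
  apply: nonincreasing_is_cvgn.
    apply/nonincreasing_seqP => p.
    by have /ler_normlP[_] := xc p; rewrite !fctE; lra.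
  exists (x 0 - c 0) => _ [p _ <-]; apply: (@le_trans _ _ (x p - c p)).
    elim: p => // p IH; apply: le_trans IH _.
    by have /ler_normlP[+ _] := xc p; lra.
  by have := c0 p; rewrite !fctE; lra.
rewrite (_ : x = (x + c) - c); first exact: is_cvgB.
by rewrite addrK.
Qed.

Lemma cvg_complex_ReIm (v : nat -> R[i]) (a b : R) :
    (fun p => complex.Re (v p)) @ \oo --> a ->
    (fun p => complex.Im (v p)) @ \oo --> b ->
  (v : nat -> R[i]^o) @ \oo --> (a +i* b : R[i]^o).
Proof.
move=> va vb; apply/cvgrPdist_lt => eps eps0.
have [e e0 ->] : exists2 e : R, 0 < e & eps = e%:C.
  move: eps0; case: eps => e f; rewrite ltcE /= => /andP[/eqP -> e0].
  by exists e.
have e20 : 0 < e / 2 by rewrite divr_gt0.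
near=> p.
rewrite [X in X < _](_ : _ = (normc (a +i* b - v p))%:C) ?ltcR//.
apply: le_lt_trans (normc_le_ReIm _) _.
rewrite [e]splitr; apply: ltrD.
  rewrite (_ : complex.Re _ = a - complex.Re (v p)); last by case: (v p).
  by near: p; move/cvgrPdist_lt : va; apply.
rewrite (_ : complex.Im _ = b - complex.Im (v p)); last by case: (v p).
by near: p; move/cvgrPdist_lt : vb; apply.
Unshelve. all: by end_near. Qed.

Lemma complex_telescoping_cvg (v : nat -> R[i]) (c : nat -> R) :
    (forall p, 0 <= c p) ->
    (forall p, normc (v p.+1 - v p) <= c p - c p.+1) ->
  exists l : R[i]^o, (v : nat -> R[i]^o) @ \oo --> l.
Proof.
move=> c0 vc.
have cvRe : cvg ((fun p => complex.Re (v p)) @ \oo).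
  apply: real_telescoping_cvg c0 _ => p; apply: le_trans (vc p).
  by apply: le_trans (Re_le_normc _); case: (v p) (v p.+1) => [? ?] [? ?].
have cvIm : cvg ((fun p => complex.Im (v p)) @ \oo).
  apply: real_telescoping_cvg c0 _ => p; apply: le_trans (vc p).
  by apply: le_trans (Im_le_normc _); case: (v p) (v p.+1) => [? ?] [? ?].
by eexists; exact: (cvg_complex_ReIm cvRe cvIm).
Qed.

(** The hypothesis reads v p.+1 = v p (1 + e_p) with |e_p| <= b p - b p.+1.
    As the sum of the |e_p| is at most b 0 <= 1/4, the sequence never moves
    further than |v 0| / 2 away from v 0: this keeps |v p| <= 2 |v 0|, so that
    the increments telescope, and keeps the limit away from 0. *)
Lemma product_cvg_neq0 (v : nat -> R[i]) (b : nat -> R) :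
    v 0 != 0 -> b 0 <= 1 / 4 -> (forall p, 0 <= b p) ->
    (forall p, b p.+1 <= b p) ->
    (forall p, normc (v p.+1 - v p) <= normc (v p) * (b p - b p.+1)) ->
  exists2 l : R[i]^o, (v : nat -> R[i]^o) @ \oo --> l & l != 0.
Proof.
move=> v0 b04 b0 bdec vb; set r := normc (v 0).
have r0 : 0 < r.
  rewrite lt_neqAle normc_ge0 andbT eq_sym; apply: contra v0 => /eqP.
  by move/Normc.eq0_normc ->.
have rb p : r * (b 0 - b p) <= r * (1 / 4).
  by apply: ler_wpM2l; [exact: ltW | have := b0 p; lra].
have vD p : normc (v p) <= normc (v p - v 0) + r.
  by rewrite -{1}[v p](subrK (v 0)) normc_add.
(* The factor 2 is the bound on |v p| / |v 0| that the induction itself maintains. *)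
have near0 p : normc (v p - v 0) <= 2 * r * (b 0 - b p).
  elim: p => [|p IH]; first by rewrite !subrr mulr0 Normc.normc0.
  rewrite -[v p.+1](subrK (v p)) -addrA; apply: le_trans (normc_add _ _) _.
  have vp2 : normc (v p) <= 2 * r.
    have := rb p.
    by have := vD p; lra.
  have : normc (v p) * (b p - b p.+1) <= 2 * r * (b p - b p.+1).
    by rewrite ler_wpM2r// subr_ge0.
  by have := vb p; lra.
have vle p : normc (v p) <= 2 * r.
  have := rb p.
  by have := vD p; have := near0 p; lra.
have [p||l vl] := @complex_telescoping_cvg v (fun p => 2 * r * b p).
- by rewrite mulr_ge0// mulr_ge0// ltW.
- move=> p; apply: le_trans (vb p) _.
  by rewrite -mulrBr ler_wpM2r// subr_ge0.
exists l => //; apply/eqP => l0; move: vl; rewrite l0 => /cvgrPdist_lt.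
have r20 : (0 : R[i]) < (r / 2)%:C by rewrite ltcR divr_gt0.
move=> /(_ _ r20) [p _] /(_ p (leqnn p)) /=.
rewrite sub0r normrN [X in X < _](_ : _ = (normc (v p))%:C)// ltcR => vp.
have : r <= normc (v p) + normc (v p - v 0).
  by have := normc_add (v p) (- (v p - v 0)); rewrite normc_opp subKr.
have := rb p.
by have := near0 p; lra.
Qed.

End ComplexSequences.

(** * Gauss's sequence and the Gamma function *)

Section GammaNonzero.
Variable R : realType.
Local Notation normc := (@Normc.normc R).

Definition cexp (w : R[i]) : R[i] :=
  (expR (complex.Re w))%:C * (cos (complex.Im w) +i* sin (complex.Im w)).

Lemma cexpD (w1 w2 : R[i]) : cexp (w1 + w2) = cexp w1 * cexp w2.
Proof.
case: w1 w2 => [a b] [c d]; rewrite /cexp /= expRD cosD sinD.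
by apply/eqP; rewrite eq_complex /=; apply/andP; split; apply/eqP; ring.
Qed.

Lemma cexp_neq0 (w : R[i]) : cexp w != 0.
Proof.
have : cexp w * cexp (- w) != 0.
  rewrite -cexpD subrr /cexp /= expR0 cos0 sin0 mul1r.
  by rewrite eq_complex /= oner_eq0.
by apply: contraNneq => ->; rewrite mul0r.
Qed.

Lemma normc_sqr (w : R[i]) :
  normc w ^+ 2 = complex.Re w ^+ 2 + complex.Im w ^+ 2.
Proof. by case: w => a b; rewrite sqr_sqrtr// addr_ge0 ?sqr_ge0. Qed.

Lemma normc_real (x : R) : normc x%:C = `|x|.
Proof. by rewrite /= expr0n addr0 sqrtr_sqr. Qed.

Lemma normc_nat (n : nat) : normc n%:R = n%:R.
Proof. by rewrite -(rmorph_nat (real_complex R)) normc_real normr_nat. Qed.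

(** Real and imaginary parts of exp (x + i y) - 1 - x - i y are split as
    (exp x - 1 - x) + exp x (cos y - 1) and (exp x - 1) sin y + (sin y - y). *)
Lemma normc_cexpB1Bid_le (w : R[i]) :
  normc w <= 1 / 2 -> normc (cexp w - 1 - w) <= 3 * normc w ^+ 2.
Proof.
move=> w2; rewrite normc_sqr; apply: le_trans (normc_le_ReIm _) _.
have := le_trans (Re_le_normc w) w2; have := le_trans (Im_le_normc w) w2.
move: {w2} w => [x y] /= y2 x2.
have ex := norm_expRB1Bid_le x2.
have y1 : `|y| <= 1 by lra.
have sy := norm_sin_le y; have sy1 := norm_sinBid_le y1.
have cy := norm_cosB1_le y.
have xy := mulr_norm_sq_le x y.
set A := (X in `|X| + _ <= _); set B := (X in _ + `|X| <= _).
have e0 := expR_gt0 x.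
have e1 : `|expR x - 1| <= 2 * `|x|.
  rewrite (_ : expR x - 1 = (expR x - 1 - x) + x); last ring.
  apply: le_trans (ler_normD _ _) _; apply: le_trans (lerD ex (lexx _)) _.
  by rewrite -[x ^+ 2]real_normK ?num_real//; have := normr_ge0 x; nra.
have e2 : `|expR x| <= 2.
  rewrite (_ : expR x = (expR x - 1) + 1); last ring.
  by apply: le_trans (ler_normD _ _) _; rewrite normr1; lra.
have AE : A = (expR x - 1 - x) + expR x * (cos y - 1) by rewrite /A; ring.
have BE : B = (expR x - 1) * sin y + (sin y - y) by rewrite /B; ring.
have hA : `|A| <= 2 * x ^+ 2 + y ^+ 2.
  rewrite AE; apply: le_trans (ler_normD _ _) _; rewrite normrM lerD//.
  by rewrite (_ : y ^+ 2 = 2 * (y ^+ 2 / 2)); [exact: ler_pM|field].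
have hB : `|B| <= x ^+ 2 + 2 * y ^+ 2.
  rewrite BE; apply: le_trans (ler_normD _ _) _; rewrite normrM.
  have : `|expR x - 1| * `|sin y| <= 2 * `|x| * `|y| by exact: ler_pM.
  lra.
lra.
Qed.

Definition lnsucc (p : nat) : R := ln (p.+1%:R) - ln p%:R.

Lemma natpowCE (p : nat) (z : R[i]) :
  natpowC p z = cexp (z * (ln (p%:R : R))%:C).
Proof.
by rewrite /natpowC /cexp; case: z => a b /=; rewrite !mulr0 subr0 add0r.
Qed.

Lemma natpowC_succ (p : nat) (z : R[i]) :
  natpowC p.+1 z = natpowC p z * cexp (z * (lnsucc p)%:C).
Proof. by rewrite !natpowCE -cexpD -mulrDr -rmorphD /= addrC subrK. Qed.

Lemma natpowCD (p : nat) (z w : R[i]) :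
  natpowC p (z + w) = natpowC p z * natpowC p w.
Proof. by rewrite !natpowCE mulrDl cexpD. Qed.

Lemma natpowC1 (p : nat) : (0 < p)%N -> natpowC p (1 : R[i]) = p%:R.
Proof.
move=> p0; rewrite /natpowC /= mul0r cos0 sin0 mul1r lnK ?posrE ?ltr0n//.
by rewrite mulr1 rmorph_nat.
Qed.

Lemma gauss_seq_succB (z : R[i]) (p : nat) : z + p.+1%:R != 0 ->
  gauss_seq z p.+1 - gauss_seq z p =
  gauss_seq z p * ((p.+1%:R * (cexp (z * (lnsucc p)%:C) - 1) - z) /
                   (z + p.+1%:R)).
Proof.
move=> zp; rewrite /gauss_seq natpowC_succ factS natrM.
rewrite /risingC [in LHS]big_ord_recr /= invfM.
set r := (\prod_(i < _) _)^-1; set E := cexp _.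
move: zp; move: (p.+1%:R) => s zp; field; exact: zp.
Qed.

(** With d = ln (1 + 1/p), the numerator divided by p + 1 is
    (exp (z d) - 1 - z d) + z (d - 1/(p + 1)); the first part is O(d^2) and
    d <= 1/p, while the denominator divided by p + 1 is at least 1/2 in
    modulus once p >= 2 |z|. *)
Lemma gauss_ratio_le (z : R[i]) (p : nat) :
    (0 < p)%N -> 2 * normc z <= p%:R ->
  normc ((p.+1%:R * (cexp (z * (lnsucc p)%:C) - 1) - z) / (z + p.+1%:R)) <=
  (12 * normc z ^+ 2 + 2 * normc z) * (p%:R^-1 - p.+1%:R^-1).
Proof.
move=> p0 zp; set N := normc z; have N0 : 0 <= N := normc_ge0 z.
rewrite -/N in zp; have P0 : 1 <= p%:R :> R by rewrite ler1n.
have Ps : p.+1%:R = p%:R + 1 :> R by rewrite -natr1.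
have /andP[d1 d2] := ln_succB_bounds R p0.
rewrite -/(lnsucc p) in d1 d2; set d := lnsucc p in d1 d2 *.
set w := z * d%:C.
have d0 : 0 <= d by apply: le_trans d1; rewrite invr_ge0 ler0n.
have Nw : normc w = N * d by rewrite /w Normc.normcM normc_real ger0_norm.
have w2 : normc w <= 1 / 2.
  rewrite Nw; apply: le_trans (ler_wpM2l N0 d2) _.
  by rewrite ler_pdivrMr; lra.
have E1 := normc_cexpB1Bid_le w2.
set s : R[i] := p.+1%:R.
have s0 : s != 0 by rewrite pnatr_eq0.
have sE : s = (p.+1%:R : R)%:C by rewrite rmorph_nat.
have -> : s * (cexp w - 1) - z =
    s * ((cexp w - 1 - w) + z * (d - p.+1%:R^-1)%:C).
  by rewrite rmorphB fmorphV /= -sE /w; field.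
rewrite Normc.normcM Normc.normcM Normc.normcV.
have lowden : p.+1%:R / 2 <= normc (z + s).
  have : normc s <= normc (z + s) + normc z.
    by have := normc_add (z + s) (- z); rewrite normc_opp addrAC subrr add0r.
  by rewrite normc_nat -/N Ps; lra.
rewrite normc_nat.
have num : normc (cexp w - 1 - w + z * (d - p.+1%:R^-1)%:C) <=
    (6 * N ^+ 2 + N) * (p%:R^-1 - p.+1%:R^-1).
  apply: le_trans (normc_add _ _) _.
  rewrite Normc.normcM normc_real -/N ger0_norm ?subr_ge0// mulrDl.
  apply: lerD; last by rewrite ler_wpM2l// lerD2r.
  apply: le_trans E1 _; rewrite Nw exprMn mulrA.
  have -> : 6 * N ^+ 2 * (p%:R^-1 - p.+1%:R^-1) =
            3 * N ^+ 2 * (2 * (p%:R^-1 - p.+1%:R^-1)) by ring.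
  rewrite ler_wpM2l ?mulr_ge0 ?sqr_ge0//.
  have dd : d ^+ 2 <= p%:R^-1 ^+ 2 by rewrite ler_sqr ?nnegrE ?invr_ge0.
  apply: le_trans dd _; rewrite Ps -subr_ge0.
  rewrite (_ : _ - _ = (p%:R - 1) / (p%:R ^+ 2 * (p%:R + 1))); last first.
    by field; apply/andP; split; apply: lt0r_neq0; lra.
  by rewrite divr_ge0// ?mulr_ge0 ?sqr_ge0//; lra.
have den : p.+1%:R / normc (z + s) <= 2.
  by rewrite ler_pdivrMr; [lra | apply: lt_le_trans lowden; rewrite Ps; lra].
rewrite mulrAC (_ : _ * (_ - _) = 2 * ((6 * N ^+ 2 + N) * (p%:R^-1 - p.+1%:R^-1))).
  by apply: ler_pM => //; [rewrite divr_ge0// normc_ge0 | exact: normc_ge0].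
by ring.
Qed.

Lemma addr_nat_neq0 (z : R[i]) (p : nat) : ~ is_nonpos_int z -> z + p%:R != 0.
Proof.
move=> znp; apply/eqP => zp; apply: znp; exists p.
by apply/eqP; rewrite -addr_eq0 zp.
Qed.

Lemma risingC_neq0 (z : R[i]) (k : nat) : ~ is_nonpos_int z -> risingC z k != 0.
Proof. by move=> znp; apply/prodf_neq0 => i _; exact: addr_nat_neq0. Qed.

Lemma gauss_seq_neq0 (z : R[i]) (p : nat) :
  ~ is_nonpos_int z -> gauss_seq z p != 0.
Proof.
move=> znp; apply: mulf_neq0; first apply: mulf_neq0.
- by rewrite pnatr_eq0 -lt0n fact_gt0.
- by rewrite natpowCE cexp_neq0.
- by rewrite invr_eq0 risingC_neq0.
Qed.

(** [product_cvg_neq0] applies to a tail of the sequence, from an index N at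
    which 2 |z| <= N and K / N <= 1/4, K being the constant of
    [gauss_ratio_le]. *)
Lemma gauss_seq_cvg_neq0 (z : R[i]) : ~ is_nonpos_int z ->
  exists2 l : R[i]^o, (gauss_seq z : nat -> R[i]^o) @ \oo --> l & l != 0.
Proof.
move=> znp; set K : R := 12 * normc z ^+ 2 + 2 * normc z.
have K0 : 0 <= K.
  by rewrite addr_ge0// mulr_ge0// ?sqr_ge0// normc_ge0.
pose N := (Num.truncn (4 * K + 2 * normc z)).+1.
have Nbig q : 4 * K + 2 * normc z <= (q + N)%:R.
  apply: le_trans (ltW (truncnS_gt _)) _.
  by rewrite ler_nat leq_addl.
have Np q : 1 <= (q + N)%:R :> R by rewrite ler1n addn_gt0 orbT.
have z0 := normc_ge0 z.
have [||||p|l vl l0] :=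
    @product_cvg_neq0 R (fun q => gauss_seq z (q + N)) (fun q => K / (q + N)%:R).
- exact: gauss_seq_neq0.
- by rewrite ler_pdivrMr; have := Nbig 0; have := Np 0; lra.
- by move=> p; rewrite divr_ge0.
- move=> p; rewrite ler_wpM2l// lef_pV2 ?posrE ?ltr0n ?addn_gt0 ?orbT//.
  by rewrite ler_nat addSn.
- rewrite addSn gauss_seq_succB;
    last exact: addr_nat_neq0.
  rewrite Normc.normcM ler_wpM2l ?normc_ge0// -mulrBr.
  by apply: gauss_ratio_le; [rewrite addn_gt0 orbT|have := Nbig p; lra].
exists l => //.
by move: vl; rewrite (cvg_shiftn N (gauss_seq z : nat -> R[i]^o)).
Qed.

Lemma Gamma_lim (z l : R[i]) :
  (gauss_seq z : nat -> R[i]^o) @ \oo --> (l : R[i]^o) -> Gamma z = l.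
Proof. by move=> zl; apply: cvg_lim zl; exact: norm_hausdorff. Qed.

Lemma Gamma_neq0 (z : R[i]) : ~ is_nonpos_int z -> Gamma z != 0.
Proof. by move=> /gauss_seq_cvg_neq0[l zl l0]; rewrite (Gamma_lim zl). Qed.

(** The factor by which Gauss's sequences at z + 1 and at z differ, apart from
    z, has this form with w = z + 1; it is also the sequence at 1. *)
Lemma cvg_inv_1Dharmonic (w : R[i]) :
  ((fun p => (1 + w * (harmonic p)%:C)^-1) : nat -> R[i]^o) @ \oo --> (1 : R[i]^o).
Proof.
have h : ((fun p => (harmonic p)%:C) : nat -> R[i]^o) @ \oo --> (0 : R[i]^o).
  by apply: cvg_complex_ReIm; [exact: cvg_harmonic | exact: cvg_cst].
have wh : ((fun p => 1 + w * (harmonic p)%:C) : nat -> R[i]^o) @ \oo -->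
    (1 + w * 0 : R[i]^o).
  exact: (cvgD (cvg_cst (1 : R[i]^o)) (cvgM (cvg_cst (w : R[i]^o)) h)).
rewrite mulr0 addr0 in wh; rewrite -[X in _ --> X]invr1.
exact: (@cvgV _ _ _ _ _ _ (oner_neq0 R[i]) wh).
Qed.

Lemma Gamma_succ (z : R[i]) : ~ is_nonpos_int z -> Gamma (z + 1) = z * Gamma z.
Proof.
move=> znp; have [l zl _] := gauss_seq_cvg_neq0 znp; rewrite (Gamma_lim zl).
apply: Gamma_lim; rewrite -cvg_shiftS -[z * l]mulr1.
have -> : [sequence gauss_seq (z + 1) p.+1]_p =
    (fun p => z * gauss_seq z p.+1 * (1 + (z + 1) * (harmonic p)%:C)^-1).
  apply/funext => p /=; rewrite /gauss_seq natpowCD natpowC1// /risingC.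
  rewrite [in LHS]big_ord_recr [in RHS]big_ord_recl /=.
  have -> : \prod_(i < p.+1) (z + 1 + i%:R) = \prod_(i < p.+1) (z + (lift ord0 i)%:R).
    by apply: eq_bigr => i _; rewrite lift0 -nat1r addrA.
  set r := \prod_(i < _) _.
  have r0 : r != 0 by apply/prodf_neq0 => i _; exact: addr_nat_neq0.
  have z0 : z != 0 by have := addr_nat_neq0 0 znp; rewrite addr0.
  have zp := addr_nat_neq0 p.+2 znp.
  rewrite /harmonic fmorphV /= rmorph_nat.
  have p0 : (p.+1%:R : R[i]) != 0 by rewrite pnatr_eq0.
  have zE : z + 1 + p.+1%:R = z + p.+2%:R by rewrite -addrA nat1r.
  rewrite addr0 zE.
  have -> : 1 + (z + 1) / p.+1%:R = (z + p.+2%:R) / p.+1%:R.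
    by rewrite -zE; field.
  move: p0 zp; move: (p.+1%:R) (p.+2%:R) => s t s0 t0; by field; rewrite s0 t0 r0 z0.
have zl1 : (fun p => gauss_seq z p.+1 : R[i]^o) @ \oo --> l.
  by rewrite (cvg_shiftS (gauss_seq z : nat -> R[i]^o)).
exact: (cvgM (cvgM (cvg_cst (z : R[i]^o)) zl1) (cvg_inv_1Dharmonic _)).
Qed.

Lemma Gamma1 : Gamma (1 : R[i]) = 1.
Proof.
apply: Gamma_lim; rewrite -cvg_shiftS.
rewrite (_ : [sequence _]_p = (fun p => (1 + 1 * (harmonic p)%:C)^-1)).
  exact: cvg_inv_1Dharmonic.
apply/funext => p /=; rewrite /gauss_seq natpowC1// /risingC.
have -> : \prod_(i < p.+2) (1 + i%:R) = (p.+2)`!%:R :> R[i].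
  by rewrite fact_prod big_add1 /= big_mkord natr_prod;
    apply: eq_bigr => i _; rewrite nat1r.
rewrite /harmonic fmorphV /= rmorph_nat mul1r [p.+2`!]factS natrM.
have p0 : (p.+1%:R : R[i]) != 0 by rewrite pnatr_eq0.
have p1 : (p.+2%:R : R[i]) != 0 by rewrite pnatr_eq0.
have f0 : ((p.+1)`!%:R : R[i]) != 0 by rewrite pnatr_eq0 -lt0n fact_gt0.
have -> : 1 + p.+1%:R^-1 = p.+2%:R / p.+1%:R :> R[i].
  by rewrite -nat1r; field.
move: p0 p1 f0; move: (p.+1%:R) (p.+2%:R) ((p.+1)`!%:R) => s t f s0 t0 f0.
by field; rewrite s0 t0 f0.
Qed.

Lemma not_nonpos_int_nat (n : nat) : ~ is_nonpos_int (n.+1%:R : R[i]).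
Proof.
by move=> [p /eqP]; rewrite -subr_eq0 opprK -natrD pnatr_eq0.
Qed.

Lemma Gamma_natS (n : nat) : Gamma (n%:R + 1 : R[i]) = n`!%:R.
Proof.
elim: n => [|n IH]; first by rewrite add0r Gamma1.
rewrite Gamma_succ; last exact: not_nonpos_int_nat.
by rewrite -natr1 IH natr1 factS natrM.
Qed.

End GammaNonzero.

(** * The Laguerre polynomials *)

Section LaguerreGamma.
Variable R : realType.
Implicit Types alpha beta z : R[i].

Lemma risingC_oppn (n k : nat) :
  risingC (- n%:R : R[i]) k = (-1) ^+ k * (k`! * 'C(n, k))%:R.
Proof.
rewrite mulnC bin_ffact /risingC.
elim: k => [|k IH]; first by rewrite big_ord0 mul1r.
rewrite big_ord_recr /= IH ffactnSr exprS.
have [kn|nk] := leqP k n; last by rewrite ffact_small// !mul0n !mulr0 mul0r.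
by rewrite natrM natrB//; ring.
Qed.

Definition Gamma_shift alpha beta (k : nat) : R[i] :=
  Gamma (alpha * k%:R + beta + 1).

Lemma Laguerre_binom_poly alpha beta (n : nat) z :
  Laguerre alpha beta n z =
  Gamma_shift alpha beta n / n`!%:R * binom_poly (Gamma_shift alpha beta) z n.
Proof.
rewrite /Laguerre Gamma_natS; congr (_ * _).
rewrite big_mkord; apply: eq_bigr => k _.
rewrite risingC_oppn natrM -/(Gamma_shift alpha beta k) (exprNn z).
have f0 : (k`!%:R : R[i]) != 0 by rewrite pnatr_eq0 -lt0n fact_gt0.
move: (k`!%:R) f0 => f f0; move: ('C(n, k)%:R) => c.
move: (Gamma_shift _ _ _)^-1 => g.
by field.
Qed.

Lemma fallingC_Gamma_shift alpha beta (n m : nat) (s : R[i]) :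
  (m <= n)%N -> s = alpha * (n - m)%:R ->
  fallingC (alpha * n%:R + beta) s =
  Gamma_shift alpha beta n / Gamma_shift alpha beta m.
Proof.
move=> mn ->; rewrite /fallingC /Gamma_shift natrB//.
by congr (_ / Gamma _); ring.
Qed.

(** When m = n, the term j = n of the coefficient divides by
    Gamma (beta - alpha + 1), which may vanish, but it carries the factor
    n - j = 0. *)
Lemma Lcoef_binom_transf alpha beta (n m : nat) : (m <= n)%N ->
  Lcoef alpha beta n m =
  (m`!%:R * n%:R)^-1 *
  binom_transf (fun j => scaled_ratio (Gamma_shift alpha beta) (n - j)) m.
Proof.
move=> mn; rewrite /Lcoef big_mkord; congr (_ * _); apply: eq_bigr => j _.
have jn : (j <= n)%N by apply: leq_trans mn; rewrite -ltnS.
rewrite -(natrB _ jn) -mulrA /scaled_ratio; congr (_ * _).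
case: (n - j)%N => [|i]; first by rewrite !mul0r.
by rewrite (@fallingC_Gamma_shift _ _ _ i)// subSnn mulr1.
Qed.

End LaguerreGamma.

Theorem theorem1 (R : realType) (alpha beta : R[i]) (n : nat)
  (hbeta : -1 < complex.Re beta) (hn : (3 <= n)%N)
  (hpole : forall k : nat, (k <= n)%N ->
     ~ is_nonpos_int (alpha * k%:R + beta + 1)) :
  forall z : R[i],
    Laguerre alpha beta n z =
    - (z / n%:R) * Laguerre alpha beta (n - 1) z +
    \sum_(1 <= m < n.+1)
      (-1) ^+ (m - 1) *
      fallingC (alpha * (n%:R - 1) + beta) ((m%:R - 1) * alpha) *
      Lcoef alpha beta n m * Laguerre alpha beta (n - m) z.
Proof.
move=> z; set G := Gamma_shift alpha beta.
have G0 k : (k <= n)%N -> G k != 0 by move=> kn; exact/Gamma_neq0/hpole.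
case: n hn hpole G0 => // n' _ _ G0; rewrite subn1 /=.
rewrite !Laguerre_binom_poly (binom_poly_recurrence _ G0); congr (_ + _).
apply: eq_big_nat => m /andP[m1 mn].
rewrite Laguerre_binom_poly Lcoef_binom_transf//.
have -> : n'.+1%:R - 1 = n'%:R :> R[i] by rewrite -natr1 addrK.
rewrite (@fallingC_Gamma_shift _ _ _ _ (n'.+1 - m)).
- by [].
- lia.
- rewrite mulrC; congr (_ * _); apply/eqP; rewrite subr_eq natr1; apply/eqP.
  by congr (_%:R); lia.
Qed.
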